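(* Let $W$ be a random variable with a Gamma distribution with shape parameter $\alpha>0$ and scale parameter $\theta>0$. Then for every $x>0$, $$\Phi\left(G_{\Gamma}(x)\right)\leq\Pr\left(W\leq x\right),$$ where $G_\Gamma$ denotes the signed log-likelihood of the distribution of $W$ and $\Phi$ is the distribution function of the standard Gaussian.
   Context: For fixed shape $\alpha$, the Gamma distributions $\Gamma(\alpha,\theta)$ (density proportional to $x^{\alpha-1}e^{-x/\theta}$ on $x>0$, mean $\alpha\theta$) form an exponential family; for $x>0$ the member with mean $x$ is $\Gamma(\alpha,x/\alpha)$. The signed log-likelihood of $\Gamma(\alpha,\theta)$ is $$G_\Gamma(x)=\begin{cases}-\left(2D\left(\Gamma(\alpha,x/\alpha)\Vert\Gamma(\alpha,\theta)\right)\right)^{1/2}, & x<\alpha\theta,\\ +\left(2D\left(\Gamma(\alpha,x/\alpha)\Vert\Gamma(\alpha,\theta)\right)\right)^{1/2}, & x\ge\alpha\theta,\end{cases}$$ where $D(P\Vert Q)=\int\ln\frac{dP}{dQ}\,dP$ is the information divergence (Kullback–Leibler divergence, natural logarithm). *)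

(* Defs.v *)
From HB Require Import structures.
From mathcomp Require Import all_boot all_order all_algebra.
From mathcomp Require Import all_classical all_reals all_analysis.
From mathcomp Require Import measurable_realfun.

Set Implicit Arguments.
Unset Strict Implicit.
Unset Printing Implicit Defensive.

Import Order.TTheory GRing.Theory Num.Theory.
Import numFieldNormedType.Exports.

Local Open Scope classical_set_scope.
Local Open Scope ring_scope.
Local Open Scope charge_scope.

Section gamma_distribution.
Context {R : realType}.
Variables alpha theta : R.
Notation mu := lebesgue_measure.

Definition gamma_kernel : R -> R :=
  (fun x => x `^ (alpha - 1) * expR (- x / theta)) \_ `]0, +oo[.

Definition gamma_norm : R := fine (\int[mu]_x (gamma_kernel x)%:E)%E.

Definition gamma_pdf (x : R) : R := gamma_kernel x / gamma_norm.

Definition gamma_prob : set R -> \bar R :=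
  fun V => (\int[mu]_(x in V) (gamma_pdf x)%:E)%E.

Lemma gamma_kernel_ge0 x : 0 <= gamma_kernel x.
Proof.
by apply: restrict_ge0 => {}x _; rewrite mulr_ge0 ?powR_ge0 ?expR_ge0.
Qed.

Lemma gamma_norm_ge0 : 0 <= gamma_norm.
Proof.
by apply/fine_ge0/integral_ge0 => x _; rewrite lee_fin gamma_kernel_ge0.
Qed.

Lemma gamma_pdf_ge0 x : 0 <= gamma_pdf x.
Proof. by rewrite divr_ge0 ?gamma_kernel_ge0 ?gamma_norm_ge0. Qed.

Lemma measurable_gamma_kernel : measurable_fun [set: R] gamma_kernel.
Proof.
apply/measurable_restrict => //; apply: measurable_funTS.
apply: measurable_funM; first exact: measurable_powR.
apply: measurableT_comp => //; apply: measurable_funM => //.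
Qed.

Lemma measurable_gamma_pdf : measurable_fun [set: R] gamma_pdf.
Proof. by apply: measurable_funM => //; exact: measurable_gamma_kernel. Qed.

Let gamma_prob0 : gamma_prob set0 = 0%E.
Proof. by rewrite /gamma_prob integral_set0. Qed.

Let gamma_prob_ge0 A : (0 <= gamma_prob A)%E.
Proof. by apply: integral_ge0 => x _; rewrite lee_fin gamma_pdf_ge0. Qed.

Let gamma_prob_sigma_additive : semi_sigma_additive gamma_prob.
Proof.
move=> /= F mF tF mUF; rewrite /gamma_prob; apply: cvg_toP.
  apply: ereal_nondecreasing_is_cvgn => m n mn.
  apply: lee_sum_nneg_natr => // k _ _; apply: integral_ge0 => /= x Fkx.
  by rewrite lee_fin gamma_pdf_ge0.
rewrite ge0_integral_bigcup//=.
- apply/measurable_funTS/measurableT_comp => //.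
  exact: measurable_gamma_pdf.
- by move=> x _; rewrite lee_fin gamma_pdf_ge0.
Qed.

HB.instance Definition _ := isMeasure.Build _ _ _ gamma_prob
  gamma_prob0 gamma_prob_ge0 gamma_prob_sigma_additive.

(* This holds for all parameters: where the kernel is not integrable,
   [gamma_norm] is 0 and so is [gamma_prob]. *)
Lemma gamma_prob_setT_le1 : (gamma_prob setT <= 1)%E.
Proof.
rewrite /gamma_prob /gamma_pdf.
under eq_integral do rewrite EFinM.
rewrite ge0_integralZr//=; last 3 first.
- by apply: measurableT_comp => //; exact: measurable_gamma_kernel.
- by move=> x _; rewrite lee_fin gamma_kernel_ge0.
- by rewrite lee_fin invr_ge0 gamma_norm_ge0.
rewrite /gamma_norm.
have : (0 <= \int[mu]_x (gamma_kernel x)%:E)%E.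
  by apply: integral_ge0 => x _; rewrite lee_fin gamma_kernel_ge0.
case: (\int[mu]_x (gamma_kernel x)%:E)%E => [r| |]//= _; last first.
  by rewrite invr0 mule0.
rewrite -EFinM lee_fin; have [->|r0] := eqVneq r 0; first by rewrite mul0r.
by rewrite divff.
Qed.

Let gamma_prob_finite : fin_num_fun gamma_prob.
Proof.
apply: lty_fin_num_fun; apply: le_lt_trans gamma_prob_setT_le1 _.
by rewrite ltry.
Qed.

HB.instance Definition _ :=
  @Measure_isFinite.Build _ _ _ gamma_prob gamma_prob_finite.

End gamma_distribution.

Definition kl_divergence (d : measure_display) (T : measurableType d)
    (R : realType) (P Q : {finite_measure set T -> \bar R}) : \bar R :=
  if `[< P `<< Q >] then
    (\int[P]_x lne (('d (charge_of_finite_measure P) '/d Q) x))%E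
  else +oo%E.

(* The divergence between Gamma distributions of the same shape is finite,
   so [fine] loses nothing for positive [alpha], [theta] and [x]. *)
Definition signed_loglik_gamma (R : realType) (alpha theta x : R) : R :=
  let D := fine (kl_divergence (gamma_prob alpha (x / alpha))
                               (gamma_prob alpha theta)) in
  if x < alpha * theta then - Num.sqrt (2 * D) else Num.sqrt (2 * D).

Definition std_gaussian_cdf (R : realType) (x : R) : \bar R :=
  normal_prob 0 1 `]-oo, x].

(* Main.v *)
(* Put t = y / (alpha * theta). The divergence of the Gamma distribution of mean
   y from that of mean alpha * theta is alpha * (t - 1 - ln t), so the signed
   log-likelihood is G(y) = sqrt(alpha) * (t - 1) * rho(t), where
   rho(t)^2 = 2 (t - 1 - ln t) / (t - 1)^2 extends continuously by 1 at t = 1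
   and decreases. The derivative of (t - 1) * rho(t) is 1 / (t * rho(t)), and it
   turns out that the Gamma density at y is C * rho(t) times the density
   phi(G(y)) G'(y) of the distribution function Phi(G(y)), for a constant C.
   Hence, with r = C * rho(x / (alpha * theta)), the Gamma distribution gives
   mass at least r * Phi(G(x)) to ]0, x] and at most r * (1 - Phi(G(x))) to
   ]x, +oo[. The first bound settles the case r >= 1, the second the case r < 1.
   No asymptotics of the Gamma function is involved: C only matters through the
   fact that both distributions have total mass 1. *)
Require Import Defs.
From HB Require Import structures.
From mathcomp Require Import all_boot all_order all_algebra.
From mathcomp Require Import all_classical all_reals all_analysis.
From mathcomp Require Import measurable_realfun ring lra.

Import Order.TTheory GRing.Theory Num.Theory.
Import numFieldNormedType.Exports.

Set Implicit Arguments.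
Unset Strict Implicit.
Unset Printing Implicit Defensive.

Local Open Scope classical_set_scope.
Local Open Scope ring_scope.

(** * Monotonicity from the sign of a derivative *)

Section derive_monotone.
Context {R : realType}.
Implicit Types (f df : R -> R) (a b : R).

Lemma ge0_is_derive_le f df a b : a <= b ->
  (forall x, a <= x <= b -> is_derive x 1 f (df x)) ->
  (forall x, a <= x <= b -> 0 <= df x) -> f a <= f b.
Proof.
move=> ab fdf df0; have [|x|c] := @MVT_segment _ f df _ _ ab.
- by move=> x; rewrite in_itv/= => /andP[/ltW ax /ltW xb]; apply: fdf; rewrite ax.
- apply: derivable_within_continuous => y; rewrite in_itv/= => yab.
  exact/ex_derive/fdf.
rewrite in_itv/= => cab fba; rewrite -subr_ge0 fba.
by rewrite mulr_ge0 ?df0// subr_ge0.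
Qed.

Lemma gt0_is_derive_lt f df a b : a < b ->
  (forall x, a <= x <= b -> is_derive x 1 f (df x)) ->
  (forall x, a <= x <= b -> 0 < df x) -> f a < f b.
Proof.
move=> ab fdf df0; have [|x|c] := @MVT_segment _ f df _ _ (ltW ab).
- by move=> x; rewrite in_itv/= => /andP[/ltW ax /ltW xb]; apply: fdf; rewrite ax.
- apply: derivable_within_continuous => y; rewrite in_itv/= => yab.
  exact/ex_derive/fdf.
rewrite in_itv/= => cab fba; rewrite -subr_gt0 fba.
by rewrite mulr_gt0 ?df0// subr_gt0.
Qed.

Lemma is_derive1_inv (x : R) : x != 0 ->
  is_derive x 1 (fun u : R => u^-1) (- x ^- 2).
Proof.
move=> x0; have dV := is_deriveV (f := id) x0 (is_derive_id x 1).
by apply: is_derive_eq; rewrite /GRing.scale/= mulr1.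
Qed.

End derive_monotone.

(** * The normalised divergence, the decreasing ratio and the signed root *)

Section gamma_rate.
Context {R : realType}.
Implicit Types s t : R.

Definition gamma_rate t := t - 1 - ln t.

(** This is [rho(t)^2] of the overview; the value at 1 fills the removable singularity. *)
Definition gamma_ratio t : R :=
  if t == 1 then 1 else 2 * gamma_rate t / (t - 1) ^+ 2.

(** The factor [t - 1] carries the sign, which makes the root differentiable across 1 without a case
    distinction. *)
Definition signed_root t := (t - 1) * Num.sqrt (gamma_ratio t).

Lemma is_derive_gamma_rate t : 0 < t -> is_derive t 1 gamma_rate (1 - t^-1).
Proof.
move=> t0; have dln := is_derive1_ln t0.
rewrite /gamma_rate; apply: is_derive_eq; lra.
Qed.

Lemma gamma_rate_gt0 t : 0 < t -> t != 1 -> 0 < gamma_rate t.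
Proof.
move=> t0 t1; have : ln t != 0 by rewrite ln_eq0.
by move=> /expR_gt1Dx; rewrite lnK// /gamma_rate; lra.
Qed.

Lemma gamma_rate1 : gamma_rate 1 = 0.
Proof. by rewrite /gamma_rate ln1; lra. Qed.

(** Both auxiliary functions are nondecreasing and vanish at 1. The sign of [k] compares
    [gamma_ratio t] with [t^-1], that of [l] compares it with 1. *)
Let k t := t - t^-1 - 2 * ln t.
Let l t := (t - 1) ^+ 2 - 2 * gamma_rate t.

Let k_le s t : 0 < s -> s <= t -> k s <= k t.
Proof.
move=> s0 st.
apply: (@ge0_is_derive_le _ k (fun x => (1 - x^-1) ^+ 2)); first exact: st.
- move=> x /andP[sx _]; have x0 : 0 < x by exact: lt_le_trans sx.
  have xn0 : x != 0 by rewrite gt_eqF.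
  have dln := is_derive1_ln x0.
  have dinv := is_derive1_inv xn0.
  rewrite /k; apply: is_derive_eq.
  rewrite /GRing.scale/=; field.
  by rewrite xn0.
- by move=> x _; exact: sqr_ge0.
Qed.

Let l_le s t : 0 < s -> s <= t -> l s <= l t.
Proof.
move=> s0 st.
apply: (@ge0_is_derive_le _ l (fun x => 2 * ((x - 1) ^+ 2 / x))); first exact: st.
- move=> x /andP[sx _]; have x0 : 0 < x by exact: lt_le_trans sx.
  have xn0 : x != 0 by rewrite gt_eqF.
  have := is_derive_gamma_rate x0 => ?.
  rewrite /l; apply: is_derive_eq.
  rewrite /GRing.scale/=; field.
  by rewrite xn0.
- move=> x /andP[sx _]; have x0 : 0 < x by exact: lt_le_trans sx.
  by rewrite mulr_ge0// divr_ge0 ?sqr_ge0// ltW.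
Qed.

Let k1 : k 1 = 0. Proof. by rewrite /k ln1 invr1; lra. Qed.
Let l1 : l 1 = 0. Proof. by rewrite /l gamma_rate1; lra. Qed.

Let ratioE t : t != 1 -> gamma_ratio t = 2 * gamma_rate t / (t - 1) ^+ 2.
Proof. by move=> t1; rewrite /gamma_ratio (negbTE t1). Qed.

Let sqr_gt0 t : t != 1 -> 0 < (t - 1) ^+ 2.
Proof. by move=> t1; rewrite exprn_even_gt0//= subr_eq0. Qed.

Lemma gamma_ratio1 : gamma_ratio 1 = 1.
Proof. by rewrite /gamma_ratio eqxx. Qed.

Lemma gamma_ratio_gt0 t : 0 < t -> 0 < gamma_ratio t.
Proof.
move=> t0; have [->|t1] := eqVneq t 1; first by rewrite gamma_ratio1.
by rewrite ratioE// divr_gt0 ?sqr_gt0// mulr_gt0// gamma_rate_gt0.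
Qed.

Let kE t : t != 0 -> k t = 2 * gamma_rate t - (t - 1) ^+ 2 / t.
Proof.
by move=> t0; rewrite /k /gamma_rate; field.
Qed.

Lemma ge1_gamma_ratio t : 1 <= t -> t^-1 <= gamma_ratio t <= 1.
Proof.
rewrite le_eqVlt => /predU1P[<-|t1]; first by rewrite gamma_ratio1 invr1 lexx.
have t0 : 0 < t by lra.
have tn1 : t != 1 by rewrite gt_eqF.
rewrite ratioE//; apply/andP; split.
  rewrite ler_pdivlMr ?sqr_gt0// mulrC.
  by have := k_le ltr01 (ltW t1); rewrite k1 kE ?gt_eqF// subr_ge0.
rewrite ler_pdivrMr ?sqr_gt0// mul1r.
by have := l_le ltr01 (ltW t1); rewrite l1 /l subr_ge0.
Qed.

Lemma le1_gamma_ratio t : 0 < t <= 1 -> 1 <= gamma_ratio t <= t^-1.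
Proof.
rewrite le_eqVlt => /andP[t0 /predU1P[->|t1]].
  by rewrite gamma_ratio1 invr1 lexx.
have tn1 : t != 1 by rewrite lt_eqF.
rewrite ratioE//; apply/andP; split.
  rewrite ler_pdivlMr ?sqr_gt0// mul1r.
  by have := l_le t0 (ltW t1); rewrite l1 /l subr_le0.
rewrite ler_pdivrMr ?sqr_gt0// [leRHS]mulrC.
by have := k_le t0 (ltW t1); rewrite k1 kE ?gt_eqF// subr_le0.
Qed.

(** Expressed through the ratio itself, the derivative has a sign that can be read off from the
    comparison of [gamma_ratio t] with [t^-1]. *)
Lemma is_derive_gamma_ratio t : 0 < t -> t != 1 ->
  is_derive t 1 gamma_ratio (2 * (t^-1 - gamma_ratio t) / (t - 1)).
Proof.
move=> t0 t1; have := is_derive_gamma_rate t0 => drate.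
have tn0 : t != 0 by rewrite gt_eqF.
have t1n : t - 1 != 0 by rewrite subr_eq0.
have sq0 : (t - 1) ^+ 2 != 0 by rewrite gt_eqF// sqr_gt0.
have dsq : is_derive t 1 (fun u : R => ((u - 1) ^+ 2)^-1) (- 2 * (t - 1) ^- 3).
  apply: is_derive_eq.
  by rewrite /GRing.scale/=; field; rewrite t1n.
apply: (@near_eq_is_derive _ _ _ (fun u => 2 * gamma_rate u * ((u - 1) ^+ 2)^-1)).
- near=> u; rewrite ratioE//; near: u.
  exact: open_neq.
- apply: is_derive_eq.
  by rewrite /GRing.scale/= ratioE//; field; rewrite t1n.
Unshelve. all: by end_near. Qed.


(** On either side of 1 the derivative is nonpositive. If 1 lies between [s] and [t], the value 1
    separates the two ratios. *)
Lemma gamma_ratio_le s t : 0 < s -> s <= t -> gamma_ratio t <= gamma_ratio s.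
Proof.
move=> s0 st.
have away : (t < 1) || (1 < s) -> gamma_ratio t <= gamma_ratio s.
  move=> st1; rewrite -lerN2.
  apply: (@ge0_is_derive_le _ (fun x => - gamma_ratio x)
    (fun x => - (2 * (x^-1 - gamma_ratio x) / (x - 1)))); first exact: st.
  - move=> x /andP[sx xt]; have x0 : 0 < x by exact: lt_le_trans sx.
    have x1 : x != 1 by case/orP: st1 => ?; apply/eqP; lra.
    have dr := is_derive_gamma_ratio x0 x1.
    exact: is_derive_eq.
  - move=> x /andP[sx xt]; have x0 : 0 < x by exact: lt_le_trans sx.
    rewrite -mulNr -mulrN opprB; case/orP: st1 => [t1|s1].
    + have /andP[_ xr] : 1 <= gamma_ratio x <= x^-1.
        by apply: le1_gamma_ratio; rewrite x0/=; lra.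
      by rewrite mulr_le0// ?invr_le0; lra.
    + have /andP[xr _] : x^-1 <= gamma_ratio x <= 1.
        by apply: ge1_gamma_ratio; lra.
      by rewrite mulr_ge0// ?invr_ge0; lra.
have [t1|t1] := ltP t 1; first by apply: away; rewrite t1.
have [s1|s1] := ltP 1 s; first by apply: away; rewrite s1 orbT.
have /andP[_ ?] := ge1_gamma_ratio t1.
have /andP[? _] : 1 <= gamma_ratio s <= s^-1.
  by apply: le1_gamma_ratio; rewrite s0.
lra.
Qed.

(** At 1 the ratio is squeezed, since it always lies between 1 and [t^-1]. *)
Lemma continuous_gamma_ratio t : 0 < t -> {for t, continuous gamma_ratio}.
Proof.
move=> t0; have [->|t1] := eqVneq t 1; last first.
  apply: differentiable_continuous; apply/derivable1_diffP.
  by case: (is_derive_gamma_ratio t0 t1).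
have cn : `|x^-1 - 1| @[x --> (1 : R)] --> (0 : R).
  have : `|x^-1 - 1| @[x --> (1 : R)] --> `|1^-1 - 1 : R|.
    apply: cvg_norm; apply: cvgB; last exact: cvg_cst.
    exact: (@inv_continuous R 1 (oner_neq0 R)).
  by rewrite invr1 subrr normr0.
rewrite /prop_for /continuous_at gamma_ratio1.
apply: (@squeeze_cvgr _ _ _ _ (fun x => 1 - `|x^-1 - 1|)
  (fun x => 1 + `|x^-1 - 1|)).
- near=> x.
  have x0 : 0 < x by near: x; exact: lt_nbhsr.
  have [x1|x1] := leP 1 x.
    have /andP[? ?] := ge1_gamma_ratio x1.
    have := ler_norm (1 - x^-1); rewrite distrC; lra.
  have /andP[? ?] : 1 <= gamma_ratio x <= x^-1.
    by apply: le1_gamma_ratio; rewrite x0 ltW.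
  have := ler_norm (x^-1 - 1); lra.
- have : (1 - `|x^-1 - 1|) @[x --> (1 : R)] --> (1 - 0 : R).
    by apply: cvgB => //; exact: cvg_cst.
  by rewrite subr0.
- have : (1 + `|x^-1 - 1|) @[x --> (1 : R)] --> (1 + 0 : R).
    by apply: cvgD => //; exact: cvg_cst.
  by rewrite addr0.
Unshelve. all: by end_near. Qed.

Lemma continuous_sqrt_gamma_ratio t : 0 < t ->
  {for t, continuous (fun u => Num.sqrt (gamma_ratio u))}.
Proof.
move=> t0; apply: continuous_comp; first exact: continuous_gamma_ratio.
exact: sqrt_continuous.
Qed.

(** Away from 1, the product rule applies and the two terms in [Num.sqrt (gamma_ratio t)] cancel. At
    1 the difference quotient is exactly [Num.sqrt (gamma_ratio (h + 1))], so continuity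
    suffices. *)
Lemma is_derive_signed_root t : 0 < t ->
  is_derive t 1 signed_root (t * Num.sqrt (gamma_ratio t))^-1.
Proof.
move=> t0; have [->|t1] := eqVneq t 1.
  rewrite gamma_ratio1 sqrtr1 mul1r invr1.
  have c0 : Num.sqrt (gamma_ratio (h + 1)) @[h --> (0 : R)] --> (1 : R).
    have : {for (0 : R), continuous
        ((fun u : R => Num.sqrt (gamma_ratio u)) \o (fun h => h + 1))}.
      apply: continuous_comp.
        by apply: cvgD; [exact: cvg_id|exact: cvg_cst].
      by apply: continuous_sqrt_gamma_ratio; rewrite add0r.
    by rewrite /prop_for /continuous_at/= add0r gamma_ratio1 sqrtr1.
  have cvg1 : (fun h : R => h^-1 *: (signed_root (h *: 1 + 1) - signed_root 1))
      @ 0^' --> (1 : R).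
    apply: (@cvg_trans _ ((fun h : R => Num.sqrt (gamma_ratio (h + 1))) @ 0^')).
      apply: near_eq_cvg; near=> h.
      have h0 : h != 0 by near: h; exact: nbhs_dnbhs_neq.
      rewrite /signed_root subrr mul0r subr0 /GRing.scale/= mulr1 addrK.
      by rewrite mulrA mulVf// mul1r.
    exact: cvg_within_filter.
  apply: DeriveDef; first by apply/cvg_ex; exists 1.
  exact: cvg_lim cvg1.
have dr := is_derive_gamma_ratio t0 t1.
have r0 := gamma_ratio_gt0 t0.
have ds := is_derive1_comp (is_derive1_sqrt r0) dr.
rewrite /signed_root; apply: is_derive_eq.
rewrite /GRing.scale/=.
have s0 : Num.sqrt (gamma_ratio t) != 0 by rewrite gt_eqF// sqrtr_gt0.
have rE : gamma_ratio t = Num.sqrt (gamma_ratio t) ^+ 2 by rewrite sqr_sqrtr// ltW.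
rewrite {2}rE; field.
by rewrite s0 gt_eqF//= subr_eq0.
Unshelve. all: by end_near. Qed.

Lemma sqr_signed_root t : 0 < t -> signed_root t ^+ 2 = 2 * gamma_rate t.
Proof.
move=> t0; rewrite /signed_root exprMn sqr_sqrtr; last exact/ltW/gamma_ratio_gt0.
rewrite /gamma_ratio; case: eqP => [->|/eqP t1].
  by rewrite gamma_rate1 subrr mulr0 expr0n mul0r.
by rewrite mulrC divfK// expf_neq0// subr_eq0.
Qed.

End gamma_rate.

(** * Bounds on rays from bounds on compact intervals, by continuity from below *)

Section measure_of_rays.
Context {R : realType}.
Local Open Scope ereal_scope.

(* [normal_prob] is a measure on the alias [measurableTypeR R] of [R], whose
   display differs from the one of [R], on which [gamma_prob] is a measure. *)
Lemma measure_itvNyc_le (nu : {measure set (measurableTypeR R) -> \bar R})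
    (c : R) (M : \bar R) :
  (forall b, nu `[b, c]%classic <= M) -> nu `]-oo, c]%classic <= M.
Proof.
move=> nuM; rewrite itvNybndEbigcup.
have ndF : nondecreasing_seq
    (fun n : nat => `](- n%:R)%R, c]%classic : set (measurableTypeR R)).
  move=> k n kn; apply/subsetPset; apply: subset_itvr.
  by rewrite bnd_simp lerN2 ler_nat.
have nucvg := @nondecreasing_cvg_mu _ _ _ nu _ (fun n => measurable_itv _)
  (bigcup_measurable (fun n _ => measurable_itv _)) ndF.
rewrite -(cvg_lim _ nucvg)//.
apply: lime_le; first by apply/cvg_ex; eexists; exact: nucvg.
apply: nearW => n /=; apply: le_trans (nuM (- n%:R)%R).
by apply: le_measure; rewrite ?inE//; apply: subset_itvr; rewrite bnd_simp.
Qed.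

Lemma measure_itvcy_le (nu : {measure set R -> \bar R}) (c : R) (M : \bar R) :
  (forall b, (c <= b)%R -> nu `[c, b]%classic <= M) ->
  nu `[c, +oo[%classic <= M.
Proof.
move=> nuM; rewrite itvbndyEbigcup.
have ndF : nondecreasing_seq
    (fun n : nat => `[c, n%:R[%classic : set R).
  move=> k n kn; apply/subsetPset; apply: subset_itvl.
  by rewrite bnd_simp ler_nat.
have nucvg := @nondecreasing_cvg_mu _ _ _ nu _ (fun n => measurable_itv _)
  (bigcup_measurable (fun n _ => measurable_itv _)) ndF.
rewrite -(cvg_lim _ nucvg)//.
apply: lime_le; first by apply/cvg_ex; eexists; exact: nucvg.
(* The hypothesis covers only right ends that are at least [c], hence the maximum. *)
apply: nearW => n /=; apply: (@le_trans _ _ (nu `[c, Num.max c n%:R]%classic)).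
  apply: le_measure; rewrite ?inE//; apply: subset_itvl.
  by rewrite bnd_simp le_max lexx orbT.
by apply: nuM; rewrite le_max lexx.
Qed.

End measure_of_rays.

(** * Comparison of the Gamma law with the Gaussian law pulled back along [G] *)

Section gamma_gauss.
Context {R : realType}.
Variables alpha theta : R.
Hypotheses (alpha_gt0 : 0 < alpha) (theta_gt0 : 0 < theta).
Local Notation mu := lebesgue_measure.
Implicit Types a b s t x y : R.
Let m := alpha * theta.
Let m_gt0 : 0 < m. Proof. exact: mulr_gt0. Qed.
Let sa_gt0 : 0 < Num.sqrt alpha. Proof. by rewrite sqrtr_gt0. Qed.
Let rho t : R := Num.sqrt (gamma_ratio t).
Let rho_gt0 t : 0 < t -> 0 < rho t.
Proof. by move=> t0; rewrite sqrtr_gt0 gamma_ratio_gt0. Qed.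

(** Closed form of the signed log-likelihood, identified with the definition by divergence in
    [signed_loglik_gammaE]; the comparison itself needs no divergence. *)
Definition gamma_loglik y : R :=
  Num.sqrt alpha * signed_root (y / (alpha * theta)).
Local Notation G := gamma_loglik.
Let dG y : R := Num.sqrt alpha / (y * rho (y / m)).

Let div_gt0 y : 0 < y -> 0 < y / m. Proof. by move=> y0; rewrite divr_gt0. Qed.

Let is_derive_gamma_loglik y : 0 < y -> is_derive y 1 G (dG y).
Proof.
move=> y0; have dr := is_derive_signed_root (div_gt0 y0).
have dlin : is_derive y 1 (fun u : R => u / m) (m^-1).
  by apply: is_derive_eq; rewrite scaler0 add0r /GRing.scale/= mulr1.
have dc := @is_derive1_comp _ signed_root (fun u => u / m) y _ _ dr dlin.
rewrite /gamma_loglik -/m; apply: is_derive_eq.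
rewrite /GRing.scale/= /dG -/(rho _); field.
by rewrite !gt_eqF//= ?rho_gt0// div_gt0.
Qed.

Let dG_gt0 y : 0 < y -> 0 < dG y.
Proof. by move=> y0; rewrite divr_gt0// mulr_gt0// rho_gt0// div_gt0. Qed.

Let continuous_dG y : 0 < y -> {for y, continuous dG}.
Proof.
move=> y0; apply: cvgM; first exact: cvg_cst.
apply: cvgV; first by rewrite gt_eqF// mulr_gt0// rho_gt0// div_gt0.
apply: cvgM; first exact: cvg_id.
apply: (@continuous_comp _ _ _ (fun u : R => u / m) rho).
  by apply: cvgM; [exact: cvg_id|exact: cvg_cst].
exact/continuous_sqrt_gamma_ratio/div_gt0.
Qed.

Let derive1_G y : 0 < y -> G^`()%classic y = dG y.
Proof.
by move=> y0; rewrite derive1E; case: (is_derive_gamma_loglik y0).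
Qed.

Let continuous_derive1_G y : 0 < y -> {for y, continuous G^`()%classic}.
Proof.
move=> y0; rewrite /prop_for /continuous_at derive1_G//.
apply: (@cvg_trans _ (dG z @[z --> y])); last exact: continuous_dG.
apply: near_eq_cvg; near=> z; rewrite derive1_G//.
by near: z; exact: lt_nbhsr.
Unshelve. all: by end_near. Qed.

Let continuous_G y : 0 < y -> {for y, continuous G}.
Proof.
move=> y0; apply: differentiable_continuous; apply/derivable1_diffP.
by case: (is_derive_gamma_loglik y0).
Qed.

(** Density on the positive half-line of the distribution function [Phi(G(y))]. *)
Let h y := normal_pdf 0 1 (G y) * dG y.

Let normal_prob_gamma_loglik a b : 0 < a -> a <= b ->
  normal_prob 0 1 `[G a, G b]%classic = (\int[mu]_(y in `[a, b]) (h y)%:E)%E.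
Proof.
move=> a0 ab; have b0 : 0 < b by exact: lt_le_trans ab.
rewrite /normal_prob integration_by_substitution_increasing//.
- apply: eq_integral => y; rewrite inE/= in_itv/= => /andP[ay _].
  by rewrite /h !fctE/= derive1_G// (lt_le_trans a0).
- move=> y z; rewrite !in_itv/= => /andP[ay _] _ yz.
  apply: (@gt0_is_derive_lt _ G dG _ _ yz) => u /andP[yu _].
    by apply: is_derive_gamma_loglik; lra.
  by apply: dG_gt0; lra.
- move=> y; rewrite in_itv/= => /andP[ay _].
  by apply: continuous_derive1_G; lra.
- apply/cvg_ex; exists (G^`()%classic a); apply: cvg_at_right_filter.
  exact: continuous_derive1_G.
- apply/cvg_ex; exists (G^`()%classic b); apply: cvg_at_left_filter.
  exact: continuous_derive1_G.
- split.
  + move=> y; rewrite in_itv/= => /andP[ay _].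
    by case: (@is_derive_gamma_loglik y); first lra.
  + by apply: cvg_at_right_filter; exact: continuous_G.
  + by apply: cvg_at_left_filter; exact: continuous_G.
- by apply: continuous_subspaceT; exact: continuous_normal_pdf.
Qed.

Let C := m `^ alpha * expR (- alpha) /
  (Num.sqrt alpha * normal_peak 1 * gamma_norm alpha theta).

(** The Gaussian exponent at [G y] is [- alpha * gamma_rate (y / m)], whose exponential is [y] times
    the Gamma kernel up to a constant. The factor [dG y] supplies the missing [y^-1] and a [rho^-1],
    which is compensated here. *)
Let gamma_pdfE y : 0 < y ->
  gamma_pdf alpha theta y = C * rho (y / m) * h y.
Proof.
move=> y0; have t0 := div_gt0 y0.
rewrite /gamma_pdf /gamma_kernel patchE ifT; last first.
  by rewrite inE/= in_itv/= y0.
rewrite /h normal_pdfE ?oner_neq0// /dG /normal_fun subr0 expr1n.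
have -> : - G y ^+ 2 / (1 *+ 2) = - alpha * gamma_rate (y / m).
  rewrite /gamma_loglik -/m exprMn sqr_signed_root// sqr_sqrtr ?ltW//.
  by field.
rewrite /gamma_rate ln_div ?posrE//.
rewrite (_ : - alpha * _ =
  - y / theta + alpha + alpha * ln y - alpha * ln m); last first.
  by rewrite /m; field; rewrite !gt_eqF.
rewrite expRB !expRD /C expRN.
have powE z : 0 < z -> expR (alpha * ln z) = z `^ alpha.
  by move=> z0; rewrite /powR gt_eqF.
rewrite !powE// powRB ?powRr1 ?(ltW y0)//; last by rewrite (gt_eqF y0) implybT.
have p0 := @normal_peak_gt0 R 1 (oner_neq0 _).
(* As the inverse of 0 is 0, a vanishing normalisation makes both sides 0. *)
have [->|Z0] := eqVneq (gamma_norm alpha theta) 0.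
  by rewrite mulr0 invr0 !(mulr0, mul0r).
field.
by rewrite Z0 !gt_eqF//= ?powR_gt0 ?expR_gt0 ?rho_gt0.
Qed.

Let C_ge0 : 0 <= C.
Proof.
rewrite divr_ge0 ?mulr_ge0 ?powR_ge0 ?expR_ge0 ?gamma_norm_ge0 ?normal_peak_ge0//.
Qed.

Let h_ge0 y : 0 < y -> 0 <= h y.
Proof. by move=> y0; rewrite mulr_ge0 ?normal_pdf_ge0// ltW// dG_gt0. Qed.

Let measurable_h a b : 0 < a -> measurable_fun `[a, b] h.
Proof.
move=> a0; apply: subspace_continuous_measurable_fun => //.
apply: continuous_in_subspaceT => y; rewrite inE/= in_itv/= => /andP[ay _].
have y0 : 0 < y by lra.
apply: cvgM; last exact: continuous_dG.
apply: continuous_comp; first exact: continuous_G.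
by apply: continuous_normal_pdf; exact: oner_neq0.
Qed.

Let rho_le s t : 0 < s -> s <= t -> rho t <= rho s.
Proof.
by move=> s0 st; rewrite ler_wsqrtr// gamma_ratio_le.
Qed.

Let mf D : measurable_fun D (EFin \o gamma_pdf alpha theta).
Proof.
by apply: measurable_funTS; apply/measurable_EFinP; exact: measurable_gamma_pdf.
Qed.

(** Since [rho] decreases, its value at [x / m] bounds the factor of the density from below to the
    left of [x], and from above to the right of [x] in [gamma_prob_le]. *)
Let le_gamma_prob a x : 0 < a -> a <= x ->
  ((C * rho (x / m))%:E * normal_prob 0 1 `[G a, G x]%classic
     <= gamma_prob alpha theta `[a, x]%classic)%E.
Proof.
move=> a0 ax; rewrite normal_prob_gamma_loglik//.
have x0 : 0 < x by lra.
have r0 : 0 <= C * rho (x / m) by rewrite mulr_ge0// sqrtr_ge0.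
rewrite -ge0_integralZl//; last 2 first.
- by apply/measurable_EFinP; exact: measurable_h.
- move=> y/=; rewrite in_itv/= => /andP[ay _]; rewrite lee_fin h_ge0//; lra.
apply: ge0_le_integral => //.
- move=> y/=; rewrite in_itv/= => /andP[ay _]; rewrite lee_fin mulr_ge0// h_ge0//.
  lra.
- by apply/measurable_EFinP/measurable_funM => //; exact: measurable_h.
- exact: mf.
- move=> y/=; rewrite in_itv/= => /andP[ay yx]; have y0 : 0 < y by lra.
  rewrite lee_fin gamma_pdfE// ler_wpM2r ?h_ge0// ler_wpM2l//.
  by rewrite rho_le ?div_gt0// ler_pM2r// invr_gt0.
Qed.

Let gamma_prob_le x b : 0 < x -> x <= b ->
  (gamma_prob alpha theta `[x, b]%classic <=
    (C * rho (x / m))%:E * normal_prob 0 1 `[G x, G b]%classic)%E.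
Proof.
move=> x0 xb; rewrite normal_prob_gamma_loglik//.
have r0 : 0 <= C * rho (x / m) by rewrite mulr_ge0// sqrtr_ge0.
rewrite -ge0_integralZl//; last 2 first.
- by apply/measurable_EFinP; exact: measurable_h.
- move=> y/=; rewrite in_itv/= => /andP[ay _]; rewrite lee_fin h_ge0//; lra.
apply: ge0_le_integral => //.
- by move=> y _; rewrite lee_fin gamma_pdf_ge0.
- exact: mf.
- by apply/measurable_EFinP/measurable_funM => //; exact: measurable_h.
- move=> y/=; rewrite in_itv/= => /andP[xy yb]; have y0 : 0 < y by lra.
  rewrite lee_fin gamma_pdfE// ler_wpM2r ?h_ge0// ler_wpM2l//.
  by rewrite rho_le ?div_gt0// ler_pM2r// invr_gt0.
Qed.

(** [G] tends to minus infinity at 0, so each Gaussian interval ending at [G x] is covered by the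
    image of some [[a, x]] with [a] positive. *)
Lemma gamma_loglik_le_small A x : 0 < x ->
  exists a, [/\ 0 < a, a <= x & G a <= A].
Proof.
(* Chosen so that [2 * alpha * (k - 1) = A ^+ 2]: for [t <= expR (- k)] one has
   [gamma_rate t >= k - 1], hence [G ^+ 2 >= A ^+ 2]. Also [k >= 1] puts [t] below 1, where [G] is
   nonpositive. *)
move=> x0; pose k := A ^+ 2 / (2 * alpha) + 1.
pose a0 := Num.min x (m * expR (- k)).
have k1 : 1 <= k by rewrite lerDr divr_ge0 ?sqr_ge0// mulr_ge0// ltW.
exists a0; rewrite lt_min x0 mulr_gt0 ?expR_gt0//=; split => //.
  by rewrite ge_min lexx.
have a0m : a0 / m <= expR (- k).
  by rewrite ler_pdivrMr// mulrC ge_min lexx orbT.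
have a00 : 0 < a0 by rewrite lt_min x0 mulr_gt0 ?expR_gt0.
have t0 := div_gt0 a00.
have t1 : a0 / m < 1.
  by apply: le_lt_trans a0m _; rewrite expR_lt1; lra.
have G0 : G a0 <= 0.
  rewrite /gamma_loglik -/m mulr_ge0_le0 ?sqrtr_ge0//.
  rewrite mulr_le0_ge0 ?sqrtr_ge0//; lra.
have lnk : k <= - ln (a0 / m).
  by rewrite lerNr -(expRK (- k)) ler_ln ?posrE ?expR_gt0.
have G2 : A ^+ 2 <= G a0 ^+ 2.
  rewrite /gamma_loglik -/m exprMn sqr_signed_root// sqr_sqrtr ?(ltW alpha_gt0)//.
  have : A ^+ 2 = 2 * alpha * (k - 1).
    by rewrite /k addrK mulrC divfK// mulf_neq0// gt_eqF.
  move=> ->; rewrite mulrA [alpha * 2]mulrC ler_wpM2l ?mulr_ge0 ?(ltW alpha_gt0)//.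
  rewrite /gamma_rate; lra.
have [A0|A0] := leP 0 A; first exact: le_trans A0.
rewrite -lerN2 -(ler_pXn2r (n := 2)) ?nnegrE ?oppr_ge0// ?sqrrN//.
exact: ltW.
Qed.

Lemma normal_prob_le_gamma_prob x : 0 < x ->
  gamma_prob alpha theta setT = 1%E ->
  (normal_prob 0 1 `]-oo, G x]%classic <=
   gamma_prob alpha theta `]-oo, x]%classic)%E.
Proof.
move=> x0 PT; set r := C * rho (x / m).
have [r1|r1] := leP 1 r.
  apply: measure_itvNyc_le => b.
  have [a [a0 ax Ga]] := gamma_loglik_le_small b x0.
  apply: (@le_trans _ _ (gamma_prob alpha theta `[a, x]%classic)); last first.
    by apply: le_measure; rewrite ?inE//; exact: subset_itvr.
  apply: le_trans (le_gamma_prob a0 ax); rewrite -/r.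
  apply: (@le_trans _ _ (normal_prob 0 1 `[G a, G x]%classic)).
    by apply: le_measure; rewrite ?inE//; apply: subset_itvr; rewrite bnd_simp.
  by rewrite -[leLHS]mul1e lee_wpmul2r// lee_fin.
(* For [r < 1] the upper tails are compared; total mass 1 on both sides then reverses the inequality
   for the lower rays. *)
have le1 : (gamma_prob alpha theta `[x, +oo[%classic <=
            normal_prob 0 1 `[G x, +oo[%classic)%E.
  apply: (@measure_itvcy_le _ (gamma_prob alpha theta)) => b xb.
  apply: le_trans (gamma_prob_le x0 xb) _; rewrite -/r.
  apply: (@le_trans _ _ (normal_prob 0 1 `[G x, G b]%classic)).
    rewrite -[leRHS]mul1e lee_wpmul2r// lee_fin; exact: ltW.
  by apply: le_measure; rewrite ?inE//; apply: subset_itvl.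
(* The Gaussian law has no atom at [G x], so the closed ray may be replaced by the complement of
   []-oo, G x]]. *)
have tailN : normal_prob 0 1 `]G x, +oo[%classic =
             normal_prob 0 1 `[G x, +oo[%classic.
  rewrite /normal_prob integral_itv_obnd_cbnd//.
  by apply: measurable_funTS; apply/measurable_EFinP; exact: measurable_normal_pdf.
have ray_compl c : ~` `]-oo, c]%classic = `]c, +oo[%classic :> set R.
  by rewrite setCitvl.
have gx : (gamma_prob alpha theta `]-oo, x]%classic +
           gamma_prob alpha theta `]x, +oo[%classic)%E = 1%E.
  by rewrite -ray_compl -measureU ?setUv ?setICr//; exact: measurableC.
have nx : (normal_prob 0 1 `]-oo, G x]%classic +
           normal_prob 0 1 `]G x, +oo[%classic)%E = 1%E.
  rewrite -ray_compl -measureU ?setUv ?setICr//; last exact: measurableC.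
  exact: probability_setT.
have gt : (gamma_prob alpha theta `]x, +oo[%classic <=
           normal_prob 0 1 `]G x, +oo[%classic)%E.
  rewrite tailN; apply: le_trans le1; apply: le_measure; rewrite ?inE//.
  by apply: subset_itvr; rewrite bnd_simp.
have fin1 : gamma_prob alpha theta `]x, +oo[%classic \is a fin_num.
  exact: fin_num_measure.
have fin2 : normal_prob 0 1 `]G x, +oo[%classic \is a fin_num.
  exact: (@fin_num_measure _ _ _ (normal_prob 0 1)).
rewrite -(leeD2rE _ _ fin2) nx -gx leeD2l//.
Qed.

End gamma_gauss.

(** * Linear substitution for Lebesgue measure and integrals *)

Section lebesgue_scaling.
Context {R : realType}.
Local Notation mu := (@lebesgue_measure R).
Local Open Scope ereal_scope.

(** The right-hand side is a measure in [A] that agrees with Lebesgue measure on half-open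
    intervals, which determine the latter. *)
Lemma lebesgue_measure_scale (c : R) (A : set (measurableTypeR R)) :
  (0 < c)%R -> measurable A -> mu A = c%:E * mu ( *%R c @^-1` A).
Proof.
move=> c0.
have mc : measurable_fun [set: measurableTypeR R]
    ( *%R c : measurableTypeR R -> measurableTypeR R).
  exact: mulrl_measurable.
pose phi : {mfun measurableTypeR R >-> measurableTypeR R} :=
  HB.pack ( *%R c) (isMeasurableFun.Build _ _ _ _ _ mc).
pose nu : {measure set (measurableTypeR R) -> \bar R} :=
  mscale (NngNum (ltW c0)) (pushforward mu phi).
apply: (@lebesgue_measure_unique _ (nu mc)) => X [[a b]] _ <- /=.
rewrite /nu/= /mscale/= /pushforward.
rewrite (_ : _ @^-1` _ = `](a / c)%R, (b / c)%R]%classic); last first.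
  apply/seteqP; split=> x /=; rewrite !in_itv/= => /andP[];
    rewrite ltr_pdivrMr// ler_pdivlMr// [(x * c)%R]mulrC => -> ->//.
rewrite !lebesgue_measure_itv/= !lte_fin ltr_pM2r ?invr_gt0//.
case: ifPn => _; last by rewrite mule0.
rewrite -!EFinB -EFinM; congr EFin.
by field; rewrite gt_eqF.
Qed.

Lemma ge0_integral_scale (c : R) (f : R -> \bar R) : (0 < c)%R ->
  measurable_fun [set: R] f -> (forall x, 0 <= f x) ->
  \int[mu]_x f x = c%:E * \int[mu]_x f (c * x)%R.
Proof.
move=> c0 mf f0.
have mc : measurable_fun [set: measurableTypeR R]
    ( *%R c : measurableTypeR R -> measurableTypeR R).
  exact: mulrl_measurable.
pose phi : {mfun measurableTypeR R >-> measurableTypeR R} :=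
  HB.pack ( *%R c) (isMeasurableFun.Build _ _ _ _ _ mc).
rewrite (eq_measure_integral (mscale (NngNum (ltW c0)) (pushforward mu phi))).
  by rewrite ge0_integral_mscale//= ge0_integral_pushforward.
by move=> A mA _; exact: (lebesgue_measure_scale c0 mA).
Qed.

End lebesgue_scaling.

(** * Normalisation, moment generating function and mean of the Gamma law *)

Section gamma_moments.
Context {R : realType}.
Variable alpha : R.
Hypothesis alpha_gt0 : 0 < alpha.
Local Notation mu := (@lebesgue_measure R).
Implicit Types theta c d x y : R.

Lemma gamma_kernel_le0 theta y : y <= 0 -> gamma_kernel alpha theta y = 0.
Proof.
move=> y0; rewrite /gamma_kernel patchE ifF//.
by apply/negbTE; rewrite notin_setE/= in_itv/= andbT; apply/negP; rewrite -leNgt.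
Qed.

Lemma gamma_kernel_gt0 theta y : 0 < y ->
  gamma_kernel alpha theta y = y `^ (alpha - 1) * expR (- y / theta).
Proof.
by move=> y0; rewrite /gamma_kernel patchE ifT// inE/= in_itv/= y0.
Qed.

Lemma gamma_kernel_scale theta c y : 0 < c ->
  gamma_kernel alpha (c * theta) (c * y) =
  c `^ (alpha - 1) * gamma_kernel alpha theta y.
Proof.
move=> c0; have [y0|y0] := leP y 0.
  by rewrite !gamma_kernel_le0 ?mulr0// pmulr_rle0.
rewrite !gamma_kernel_gt0 ?mulr_gt0// powRM ?ltW// -mulrA.
congr (_ * (_ * expR _)).
by rewrite invfM mulrA; congr (_ * _); field; rewrite gt_eqF.
Qed.

Let mkernel theta : measurable_fun [set: R] (EFin \o gamma_kernel alpha theta).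
Proof. by apply/measurable_EFinP; exact: measurable_gamma_kernel. Qed.

(** A zero normalisation, which is also what [fine] gives for a divergent integral, would make the
    density vanish. Convergence of the Gamma integral is thus read off from total mass 1. *)
Lemma gamma_norm_gt0 theta :
  gamma_prob alpha theta setT = 1%E -> 0 < gamma_norm alpha theta.
Proof.
move=> PT; rewrite lt_neqAle gamma_norm_ge0 andbT eq_sym.
apply/eqP => Z0; move: PT; rewrite /gamma_prob /gamma_pdf Z0.
under eq_integral do rewrite invr0 mulr0.
by rewrite integral0 => /eqP; rewrite eq_sym onee_eq0.
Qed.

Lemma integral_gamma_kernel theta : 0 < gamma_norm alpha theta ->
  (\int[mu]_x (gamma_kernel alpha theta x)%:E = (gamma_norm alpha theta)%:E)%E.
Proof.
rewrite /gamma_norm => Z0; rewrite fineK//.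
by case: (integral _ _ _) Z0 => //=; rewrite ltxx.
Qed.

Lemma integral_gamma_kernel_scale theta c : 0 < c ->
  0 < gamma_norm alpha theta ->
  (\int[mu]_x (gamma_kernel alpha (c * theta) x)%:E =
   (c `^ alpha * gamma_norm alpha theta)%:E)%E.
Proof.
move=> c0 Z0; rewrite (ge0_integral_scale (f := EFin \o _) c0)//=; last first.
  by move=> x; rewrite lee_fin gamma_kernel_ge0.
under eq_integral do rewrite gamma_kernel_scale// EFinM.
rewrite ge0_integralZl//=; last 3 first.
- exact: mkernel.
- by move=> x _; rewrite lee_fin gamma_kernel_ge0.
- by rewrite lee_fin powR_ge0.
rewrite integral_gamma_kernel// -!EFinM mulrA; congr (_ * _)%:E.
by rewrite mulr_powRB1// ltW.
Qed.

Lemma gamma_norm_scale theta c : 0 < c -> 0 < gamma_norm alpha theta ->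
  gamma_norm alpha (c * theta) = c `^ alpha * gamma_norm alpha theta.
Proof.
by move=> c0 Z0; rewrite {1}/gamma_norm integral_gamma_kernel_scale.
Qed.

Let mpdf theta : measurable_fun [set: R] (EFin \o gamma_pdf alpha theta).
Proof. by apply/measurable_EFinP; exact: measurable_gamma_pdf. Qed.

Let pdf_ge0 theta y : (0 <= (gamma_pdf alpha theta y)%:E)%E.
Proof. by rewrite lee_fin gamma_pdf_ge0. Qed.

Lemma gamma_pdf_le0 theta y : y <= 0 -> gamma_pdf alpha theta y = 0.
Proof. by move=> y0; rewrite /gamma_pdf gamma_kernel_le0 ?mul0r. Qed.

(** Exponential tilting by [d] turns the kernel of scale [theta] into that of scale [c * theta], so
    only two normalisations have to be compared. *)
Lemma integral_gamma_pdf_expR theta d : 0 < theta -> d * theta < 1 ->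
  0 < gamma_norm alpha theta ->
  (\int[mu]_y (expR (d * y) * gamma_pdf alpha theta y)%:E =
   ((1 - d * theta) `^ (- alpha))%:E)%E.
Proof.
move=> theta0 dt Z0; set c := (1 - d * theta)^-1.
have c0 : 0 < c by rewrite invr_gt0 subr_gt0.
transitivity (\int[mu]_y ((gamma_norm alpha theta)^-1%:E *
    (gamma_kernel alpha (c * theta) y)%:E))%E.
  apply: eq_integral => y _; rewrite -EFinM; congr EFin.
  rewrite /gamma_pdf mulrA mulrC; congr (_ * _).
  have [y0|y0] := leP y 0; first by rewrite !gamma_kernel_le0 ?mulr0.
  rewrite !gamma_kernel_gt0// mulrCA -expRD; congr (_ * expR _).
  by rewrite /c; field; rewrite !gt_eqF ?subr_gt0.
rewrite ge0_integralZl//=; last 3 first.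
- exact: mkernel.
- by move=> x _; rewrite lee_fin gamma_kernel_ge0.
- by rewrite lee_fin invr_ge0 ltW.
rewrite integral_gamma_kernel_scale// -EFinM mulrCA mulVf ?gt_eqF// mulr1.
by rewrite powRN /c -powR_inv1 ?subr_ge0 ?ltW// -powRrM mulN1r powRN.
Qed.

Lemma integral_gamma_pdf theta : 0 < gamma_norm alpha theta ->
  (\int[mu]_y (gamma_pdf alpha theta y)%:E = 1)%E.
Proof.
move=> Z0; rewrite /gamma_pdf; under eq_integral do rewrite EFinM.
rewrite ge0_integralZr//=; last 3 first.
- exact: mkernel.
- by move=> x _; rewrite lee_fin gamma_kernel_ge0.
- by rewrite lee_fin invr_ge0 ltW.
by rewrite integral_gamma_kernel// -EFinM mulfV// gt_eqF.
Qed.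

Lemma integrable_gamma_pdf theta : 0 < gamma_norm alpha theta ->
  mu.-integrable [set: R] (EFin \o gamma_pdf alpha theta).
Proof.
move=> Z0; apply/integrableP; split; first exact: mpdf.
under eq_integral do rewrite /= ger0_norm ?gamma_pdf_ge0//.
by rewrite integral_gamma_pdf// ltry.
Qed.

Lemma integrable_gamma_pdf_expR theta d : 0 < theta -> d * theta < 1 ->
  0 < gamma_norm alpha theta ->
  mu.-integrable [set: R] (fun y => (expR (d * y) * gamma_pdf alpha theta y)%:E).
Proof.
move=> theta0 dt Z0; apply/integrableP; split.
  apply/measurable_EFinP/measurable_funM; last exact: measurable_gamma_pdf.
  by apply: measurableT_comp => //; exact: mulrl_measurable.
under eq_integral.
  move=> y _; rewrite gee0_abs; last first.
    by rewrite lee_fin mulr_ge0 ?expR_ge0 ?gamma_pdf_ge0.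
  over.
by rewrite integral_gamma_pdf_expR// ltry.
Qed.

Lemma integrable_gamma_pdf_id theta : 0 < theta ->
  0 < gamma_norm alpha theta ->
  mu.-integrable [set: R] (fun y => (y * gamma_pdf alpha theta y)%:E).
Proof.
(* With [d * theta = 1 / 2] the moment generating function is finite at [d], and
   [d * y <= expR (d * y)] gives the dominating function. *)
move=> theta0 Z0; pose d := (2 * theta)^-1.
have d0 : 0 < d by rewrite invr_gt0 mulr_gt0.
have dt : d * theta < 1.
  by rewrite /d invfM divfK ?gt_eqF// invf_lt1// ltr1n.
apply: (@le_integrable _ _ _ mu _ _ _
  (fun y => d^-1%:E * (expR (d * y) * gamma_pdf alpha theta y)%:E)%E) => //.
- apply/measurable_EFinP/measurable_funM => //; exact: measurable_gamma_pdf.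
- move=> y _; rewrite -EFinM !abse_EFin lee_fin.
  have [y0|y0] := leP y 0; first by rewrite gamma_pdf_le0// !mulr0 normr0.
  rewrite [d^-1 * _]mulrA !(normrM _ (gamma_pdf alpha theta y)) ler_wpM2r//.
  rewrite !gtr0_norm//; last first.
    by apply: mulr_gt0; [rewrite invr_gt0|exact: expR_gt0].
  rewrite ler_pdivlMl//.
  by apply: le_trans (expR_ge1Dx _); rewrite lerDr.
- by apply: integrableZl => //; exact: integrable_gamma_pdf_expR.
Qed.

(* The moment generating function lies above its tangent at 0 because
   [1 + u <= expR u], so its derivative there is the mean. *)
Lemma integral_gamma_pdf_id theta : 0 < theta ->
  0 < gamma_norm alpha theta ->
  (\int[mu]_y (y * gamma_pdf alpha theta y)%:E = (alpha * theta)%:E)%E.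
Proof.
move=> theta0 Z0; have iE := integrable_gamma_pdf_id theta0 Z0.
have finE := integrable_fin_num measurableT iE.
rewrite -(fineK finE); set E := fine _; congr EFin.
have mgf d : d * theta < 1 -> 1 + d * E <= (1 - d * theta) `^ (- alpha).
  move=> dt; rewrite -lee_fin -integral_gamma_pdf_expR//.
  rewrite EFinD EFinM /E fineK// -(integral_gamma_pdf Z0).
  rewrite -integralZl//; rewrite -integralD//; last 2 first.
  - exact: integrable_gamma_pdf.
  - exact: integrableZl.
  apply: le_integral => //.
  - apply: integrableD => //; first exact: integrable_gamma_pdf.
    exact: integrableZl.
  - exact: integrable_gamma_pdf_expR.
  - move=> y _; rewrite -EFinM -EFinD lee_fin mulrA -[X in X + _]mul1r -mulrDl.
    by rewrite ler_wpM2r ?gamma_pdf_ge0// expR_ge1Dx.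
(* The gap between the moment generating function and its tangent is nonnegative and zero at 0, so
   its derivative [alpha * theta - E] there vanishes. *)
pose phi d : R := (1 - d * theta) `^ (- alpha) - (1 + d * E).
have dphi d : d * theta < 1 -> is_derive d 1 phi
    (alpha * theta * (1 - d * theta) `^ (- alpha - 1) - E).
  move=> dt; have dt0 : 0 < 1 - d * theta by rewrite subr_gt0.
  have dp := is_derive1_powR (- alpha) dt0.
  have dl : is_derive d 1 (fun u : R => 1 - u * theta) (- theta).
    by apply: is_derive_eq; rewrite scaler0 /GRing.scale/=; ring.
  have dc := @is_derive1_comp _ (fun u => u `^ (- alpha)) (fun u => 1 - u * theta)
    d _ _ dp dl.
  rewrite /phi; apply: is_derive_eq.
  by rewrite /GRing.scale/=; ring.
have smallP d : d \in `](- theta^-1), theta^-1[%R -> d * theta < 1.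
  by rewrite in_itv/= => /andP[_]; rewrite -ltr_pdivlMr// div1r.
have mem0 : 0 \in `](- theta^-1), theta^-1[%R.
  by rewrite in_itv/= oppr_lt0 invr_gt0 theta0.
have d0 : is_derive (0 : R) 1 phi 0.
  apply: (@derive1_at_min _ phi (- theta^-1) theta^-1) => //.
  - by rewrite ge0_cp// invr_ge0 ltW.
  - by move=> d /smallP dt; case: (dphi d dt).
  - move=> d /smallP dt; rewrite {1}/phi !mul0r subr0 powR1 addr0 subrr.
    by rewrite subr_ge0 mgf.
have [_ e1] := dphi 0 (smallP 0 mem0); have [_ e2] := d0.
move: e1; rewrite e2 mul0r subr0 powR1 mulr1 => /eqP.
by rewrite eq_sym subr_eq0 => /eqP.
Qed.

End gamma_moments.

(* The charge and Radon-Nikodym theory needs all measures on the same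
   [measurableType], hence this copy of [lebesgue_measure] on [R] itself rather
   than on its alias [measurableTypeR R]. *)
Definition lebesgueR {R : realType} : set R -> \bar R := @lebesgue_measure R.

(** * Lebesgue measure on [R] itself *)

Section lebesgueR_measure.
Context {R : realType}.
Local Open Scope ereal_scope.

Let lebesgueR0 : @lebesgueR R set0 = 0.
Proof. exact: (measure0 (@lebesgue_measure R)). Qed.

Let lebesgueR_ge0 A : 0 <= @lebesgueR R A.
Proof. exact: (measure_ge0 (@lebesgue_measure R)). Qed.

Let lebesgueR_sigma_additive : semi_sigma_additive (@lebesgueR R).
Proof. exact: (@measure_semi_sigma_additive _ _ _ (@lebesgue_measure R)). Qed.

HB.instance Definition _ := isMeasure.Build _ _ _ (@lebesgueR R)
  lebesgueR0 lebesgueR_ge0 lebesgueR_sigma_additive.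

Let lebesgueR_sigma_finite : sigma_finite [set: R] (@lebesgueR R).
Proof. exact: (@sigma_finiteT _ _ _ (@lebesgue_measure R)). Qed.

HB.instance Definition _ :=
  @Measure_isSigmaFinite.Build _ _ _ (@lebesgueR R) lebesgueR_sigma_finite.

(** The identity is measurable between the two copies of the line and pushes one measure to the
    other. *)
Lemma ge0_integral_lebesgueR (D : set R) (f : R -> \bar R) :
  measurable D -> measurable_fun D f -> (forall x, 0 <= f x) ->
  \int[@lebesgueR R]_(x in D) f x = \int[lebesgue_measure]_(x in D) f x.
Proof.
move=> mD mf f0.
have mid : measurable_fun [set: measurableTypeR R] (id : measurableTypeR R -> R).
  by move=> _ Y mY; rewrite setTI.
pose phi : {mfun measurableTypeR R >-> R} :=
  HB.pack (id : measurableTypeR R -> R) (isMeasurableFun.Build _ _ _ _ _ mid).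
rewrite (eq_measure_integral (pushforward lebesgue_measure phi)).
  by rewrite ge0_integral_pushforward.
by [].
Qed.

End lebesgueR_measure.

(** * Radon-Nikodym derivative and divergence for two Gamma laws of equal shape *)

Section kl_gamma.
Context {R : realType}.
Variables alpha theta theta' : R.
Hypothesis alpha_gt0 : 0 < alpha.
Hypotheses (theta_gt0 : 0 < theta) (theta'_gt0 : 0 < theta').
Hypothesis norm_gt0 : 0 < gamma_norm alpha theta.
Local Notation la := (@lebesgueR R).
Local Notation P := (gamma_prob alpha theta').
Local Notation Q := (gamma_prob alpha theta).
Implicit Types t y : R.

Let mpdf t : measurable_fun [set: R] (EFin \o gamma_pdf alpha t).
Proof. by apply/measurable_EFinP; exact: measurable_gamma_pdf. Qed.

Let pdf_ge0 t y : (0 <= (gamma_pdf alpha t y)%:E)%E.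
Proof. by rewrite lee_fin gamma_pdf_ge0. Qed.

Lemma gamma_prob_lebesgueR t (A : set R) : measurable A ->
  gamma_prob alpha t A = (\int[la]_(y in A) (gamma_pdf alpha t y)%:E)%E.
Proof.
by move=> mA; rewrite ge0_integral_lebesgueR//; exact: measurable_funTS (mpdf t).
Qed.

(** The likelihood ratio: the powers of [y] cancel because the shapes agree, and the normalisations
    differ by a power of [theta' / theta]. *)
Let ratio : R -> R :=
  fun y => (theta / theta') `^ alpha * expR (y * (theta^-1 - theta'^-1)).

Let norm'E :
  gamma_norm alpha theta' = (theta' / theta) `^ alpha * gamma_norm alpha theta.
Proof.
rewrite -(@gamma_norm_scale _ alpha _ theta (theta' / theta)) ?divr_gt0//.
by rewrite divfK// gt_eqF.
Qed.

Let norm'_gt0 : 0 < gamma_norm alpha theta'.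
Proof. by rewrite norm'E mulr_gt0// powR_gt0// divr_gt0. Qed.

Let gamma_pdf_ratio y :
  gamma_pdf alpha theta' y = ratio y * gamma_pdf alpha theta y.
Proof.
have [y0|y0] := leP y 0; first by rewrite !gamma_pdf_le0 ?mulr0.
rewrite /gamma_pdf norm'E !gamma_kernel_gt0// /ratio.
have -> : (theta / theta') `^ alpha = ((theta' / theta) `^ alpha)^-1.
  rewrite (_ : theta / theta' = (theta' / theta) `^ (-1)).
    by rewrite -powRrM mulN1r powRN.
  by rewrite powR_inv1 ?invf_div// divr_ge0// ltW.
have -> : - y / theta' = y * (theta^-1 - theta'^-1) - y / theta by ring.
rewrite expRD mulNr; field.
by rewrite !gt_eqF// powR_gt0// divr_gt0.
Qed.

Lemma gamma_dominates_lebesgueR t : gamma_prob alpha t `<< la.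
Proof.
apply/null_content_dominatesP => A mA A0.
rewrite gamma_prob_lebesgueR// null_set_integral//.
exact: measurable_funTS (mpdf t).
Qed.

(** On a null set of [Q] the density of [Q] vanishes almost everywhere, hence so does its multiple
    by [ratio]. *)
Lemma gamma_dominates : P `<< Q.
Proof.
apply/null_content_dominatesP => A mA; rewrite gamma_prob_lebesgueR// => QA.
have {}QA : (\int[la]_(y in A) (gamma_pdf alpha theta y)%:E = 0)%E.
  by rewrite -gamma_prob_lebesgueR.
have : ae_eq la A (EFin \o gamma_pdf alpha theta) (cst 0%E).
  apply/ae_eq_integral_abs => //; first exact: measurable_funTS (mpdf theta).
  by rewrite -[RHS]QA; apply: eq_integral => y _; exact/gee0_abs/pdf_ge0.
move=> q0; transitivity (\int[la]_(y in A) cst 0%E y)%E; last exact: integral0.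
apply: ae_eq_integral.
- exact: mA.
- exact: measurable_funTS (mpdf theta').
- exact: measurable_cst.
- apply: filterS q0 => y /= q0 Ay.
  by rewrite gamma_pdf_ratio EFinM (q0 Ay) mule0.
Qed.

Lemma Radon_Nikodym_gamma_lebesgueR t : 0 < gamma_norm alpha t ->
  ae_eq la setT (Radon_Nikodym (charge_of_finite_measure (gamma_prob alpha t)) la)
    (EFin \o gamma_pdf alpha t).
Proof.
move=> Z0; apply: integral_ae_eq => //.
- apply: Radon_Nikodym_integrable; exact: gamma_dominates_lebesgueR.
- move=> E _ mE; rewrite -Radon_Nikodym_integral//.
    exact: gamma_prob_lebesgueR.
  exact: gamma_dominates_lebesgueR.
Qed.

Lemma ge0_integral_gamma t (f : R -> \bar R) : 0 < gamma_norm alpha t ->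
  measurable_fun [set: R] f -> (forall y, 0 <= f y)%E ->
  (\int[gamma_prob alpha t]_y f y =
   \int[lebesgue_measure]_y (f y * (gamma_pdf alpha t y)%:E))%E.
Proof.
move=> Z0 mf f0.
rewrite -ge0_integral_lebesgueR//; last 2 first.
- by apply: emeasurable_funM => //; exact: mpdf.
- by move=> y; rewrite mule_ge0.
have dom := gamma_dominates_lebesgueR t.
rewrite -(Radon_Nikodym_SigmaFinite.change_of_variables dom)//.
apply: ae_eq_integral => //.
- apply: emeasurable_funM => //.
  exact: measurable_int (Radon_Nikodym_SigmaFinite.f_integrable dom).
- by apply: emeasurable_funM => //; exact: mpdf.
- apply: ae_eqe_mul2l.
  apply: ae_eq_trans (Radon_Nikodym_gamma_lebesgueR Z0).
  exact: (ae_eq_Radon_Nikodym_SigmaFinite dom).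
Qed.

Lemma gamma_ae_gt0 t : {ae gamma_prob alpha t, forall y : R, 0 < y}.
Proof.
exists `]-oo, 0]%classic; split => //.
- rewrite gamma_prob_lebesgueR//; apply: integral0_eq => y /=.
  by rewrite in_itv/= => y0; rewrite gamma_pdf_le0.
- by move=> y /= /negP; rewrite -leNgt in_itv/=.
Qed.

Let RN := Radon_Nikodym (charge_of_finite_measure P) Q.

(** The chain rule through Lebesgue measure gives [RN] times the density of [Q] as the density of
    [P]. Division is allowed for positive [y], where the density of [Q] is positive, and these [y]
    have full measure under [P]. *)
Let Radon_Nikodym_gamma : {ae P, forall y, RN y = (ratio y)%:E}.
Proof.
have chain := @Radon_Nikodym_chain_rule _ _ _ (charge_of_finite_measure P)
  la Q gamma_dominates (gamma_dominates_lebesgueR theta).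
have RNla : {ae la, forall y, (gamma_pdf alpha theta' y)%:E =
    (RN y * (gamma_pdf alpha theta y)%:E)%E}.
  have := Radon_Nikodym_gamma_lebesgueR norm_gt0.
  have := Radon_Nikodym_gamma_lebesgueR norm'_gt0.
  apply: filterS3 chain => y /= h1 h2 h3.
  apply: (etrans (esym (h2 Logic.I))); apply: (etrans (h1 Logic.I)).
  exact: (congr1 (fun u => RN y * u)%E (h3 Logic.I)).
have RNP : {ae P, forall y, (gamma_pdf alpha theta' y)%:E =
    (RN y * (gamma_pdf alpha theta y)%:E)%E}.
  have /null_content_dominatesP dom := gamma_dominates_lebesgueR theta'.
  by case: RNla => N [mN N0 sN]; exists N; split => //; exact: dom.
apply: filterS2 (gamma_ae_gt0 theta') RNP => y y0.
have q0 : 0 < gamma_pdf alpha theta y.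
  rewrite /gamma_pdf gamma_kernel_gt0// divr_gt0// mulr_gt0 ?expR_gt0//.
  exact: powR_gt0.
rewrite gamma_pdf_ratio.
have /fineK <- : RN y \is a fin_num.
  exact: (@Radon_Nikodym_fin_num _ _ _ (charge_of_finite_measure P) Q _
    gamma_dominates).
rewrite -EFinM => -[] h; congr EFin; apply/esym.
by apply: mulIf h; rewrite gt_eqF.
Qed.

(** The logarithm of [ratio] is affine in [y], so its expectation under [P] needs only the total
    mass and the mean [alpha * theta']. *)
Lemma kl_divergence_gamma :
  kl_divergence P Q = (alpha * gamma_rate (theta' / theta))%:E.
Proof.
rewrite /kl_divergence asboolT; last exact: gamma_dominates.
pose a := alpha * ln (theta / theta').
pose b := theta^-1 - theta'^-1.
(* [Num.max y 0] equals [y] almost surely and is nonnegative everywhere, as [ge0_integral_gamma]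
   requires. *)
rewrite (ae_eq_integral (fun y => a%:E + b%:E * (Num.max y 0)%:E)%E)//;
  last 3 first.
(* Finiteness of [RN] reduces the measurability of [lne] to that of the real [ln]. *)
- have -> : (fun x => lne (RN x)) = (fun x => if (RN x <= 0)%E then -oo%E
      else (ln (fine (RN x)))%:E).
    apply/funext => y.
    have : RN y \is a fin_num.
      exact: (@Radon_Nikodym_fin_num _ _ _ (charge_of_finite_measure P) Q _
        gamma_dominates).
    by case: (RN y) => // r _; rewrite lee_fin.
  have mRN : measurable_fun setT RN.
    apply: measurable_int; apply: Radon_Nikodym_integrable.
    exact: gamma_dominates.
  apply: measurable_fun_ifT => //.
    exact: (measurable_fun_lee mRN (measurable_cst _)).
  apply/measurable_EFinP; apply: measurableT_comp; first exact: measurable_ln.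
  apply: measurableT_comp => //.
- apply/measurable_EFinP; apply: measurable_funD => //.
  apply: measurable_funM => //.
  exact: measurable_maxr.
- apply: filterS2 (gamma_ae_gt0 theta') Radon_Nikodym_gamma => y y0 RNy _.
  rewrite -[X in lne X]/(RN y) RNy.
  rewrite lne_EFin ?mulr_gt0 ?expR_gt0 ?powR_gt0 ?divr_gt0//.
  rewrite lnM ?posrE ?expR_gt0 ?powR_gt0 ?divr_gt0// ln_powR expRK.
  by rewrite -EFinM -EFinD max_l ?(ltW y0)// [b * y]mulrC.
have EM : (\int[P]_y (Num.max y 0)%:E = (alpha * theta')%:E)%E.
  rewrite ge0_integral_gamma//; last 2 first.
  - by apply/measurable_EFinP; exact: measurable_maxr.
  - by move=> y; rewrite lee_fin le_max lexx orbT.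
  rewrite -integral_gamma_pdf_id//; apply: eq_integral => y _.
  rewrite -EFinM; congr EFin; case: (leP y 0) => y0; last by [].
  by rewrite gamma_pdf_le0// !mulr0.
have iM : P.-integrable setT (fun y => (Num.max y 0)%:E).
  apply/integrableP; split; first by apply/measurable_EFinP; exact: measurable_maxr.
  under eq_integral.
    move=> y _; rewrite gee0_abs; last by rewrite lee_fin le_max lexx orbT.
    over.
  by rewrite EM ltry.
rewrite integralD//; last 2 first.
- exact: finite_measure_integrable_cst.
- exact: integrableZl.
rewrite integral_cst// integralZl// EM.
rewrite [X in (_ * X + _)%E](_ : _ = 1%E); last exact: integral_gamma_pdf.
rewrite mule1 -EFinM -EFinD; congr EFin.
rewrite /a /b /gamma_rate !ln_div ?posrE//.
by field; rewrite !gt_eqF.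
Qed.

End kl_gamma.

(** * Identification of the signed log-likelihood, and conclusion *)

(** Twice the divergence is [alpha] times a squared [signed_root]; its root is an absolute value,
    and the case distinction at the mean restores the sign. *)
Lemma signed_loglik_gammaE (R : realType) (alpha theta x : R) :
  0 < alpha -> 0 < theta -> 0 < x -> 0 < gamma_norm alpha theta ->
  signed_loglik_gamma alpha theta x = gamma_loglik alpha theta x.
Proof.
move=> a0 t0 x0 Z0; have m0 : 0 < alpha * theta by rewrite mulr_gt0.
rewrite /signed_loglik_gamma kl_divergence_gamma ?divr_gt0//=.
have -> : x / alpha / theta = x / (alpha * theta) by rewrite invfM mulrA.
rewrite mulrCA sqrtrM ?(ltW a0)// -sqr_signed_root ?divr_gt0// sqrtr_sqr.
rewrite /gamma_loglik /signed_root normrM (ger0_norm (sqrtr_ge0 _)).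
case: ltP => xm.
  rewrite ltr0_norm ?mulNr ?mulrN ?opprK//.
  by rewrite subr_lt0 ltr_pdivrMr// mul1r.
by rewrite ger0_norm// subr_ge0 ler_pdivlMr// mul1r.
Qed.

Theorem corollary9 (R : realType) (d : measure_display) (T : measurableType d)
    (P : probability T R) (W : {RV P >-> R}) (alpha theta : R)
    (alpha_gt0 : 0 < alpha) (theta_gt0 : 0 < theta)
    (W_gamma : forall A : set R, measurable A ->
      distribution P W A = gamma_prob alpha theta A)
    (x : R) (x_gt0 : 0 < x) :
  (std_gaussian_cdf (signed_loglik_gamma alpha theta x)
     <= P [set w | (W w <= x)%R])%E.
Proof.
(* Total mass 1 is inherited from the law of [W]; it also yields the positive normalisation. *)
have PT : gamma_prob alpha theta setT = 1%E.
  by rewrite -W_gamma//; exact: probability_setT.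
rewrite signed_loglik_gammaE//; last exact: gamma_norm_gt0.
have -> : P [set w | W w <= x] = gamma_prob alpha theta `]-oo, x]%classic.
  by rewrite -W_gamma// /distribution /pushforward; congr (P _).
exact: normal_prob_le_gamma_prob.
Qed.
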